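(* Let $k$ and $s$ be odd coprime integers, let $K=\mathbb{F}_{2^{2k}}$ and $L=\mathbb{F}_{2^k}\subset K$, let $b$ be a primitive element of $K$ and let $c\in K\setminus L$. Then the function $f:K\to K$, $$f(x)=bx^{2^s+1}+(bx^{2^s+1})^{2^k}+cx^{2^k+1},$$ is not CCZ-equivalent to any Gold function $x\mapsto x^{2^r+1}$ on $K$, where $r$ is a positive integer with $\gcd(r,2k)=1$.
   Context: A primitive element of $K$ is a generator of the multiplicative group $K^*$. Two functions $f,g:K\to K$ are CCZ-equivalent if there is an $\mathbb{F}_2$-affine permutation of $K\times K$ mapping the graph $\{(x,f(x)) : x\in K\}$ onto the graph $\{(x,g(x)) : x\in K\}$.
   Formalization: The formal theorem assumes k > 1: for k = 1 the claim is false, since on F_4 one has f(x) = (1+c)x^3 with 1+c nonzero, which is linearly equivalent to the Gold function x^3. *)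

(* Defs.v *)
From HB Require Import structures.
From mathcomp Require Import all_boot all_order all_fingroup all_algebra all_field.

Set Implicit Arguments.
Unset Strict Implicit.
Unset Printing Implicit Defensive.

Import GRing.Theory.
Local Open Scope ring_scope.

(* The finite field with 2 ^ n elements is represented as a field extension of
   'F_2 of dimension n, so that its F_2-linear structure and its subfields are
   those of the library. *)

(* The exponent [i] is an integer: [b] generates the group of nonzero
   elements. *)
Definition primitive_element (K : fieldType) (b : K) : Prop :=
  b != 0 /\ forall x : K, x != 0 -> exists i : int, x = b ^ i.

Definition affine_permutation (F : fieldType) (V : vectType F) (A : V -> V) :
    Prop :=
  bijective A /\ exists (l : 'End(V)) (a : V), forall v, A v = l v + a.

Definition graph (K : Type) (f : K -> K) (v : K * K) : Prop :=
  exists x : K, v = (x, f x).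

Definition CCZ_equivalent (K : fieldExtType 'F_2) (f g : K -> K) : Prop :=
  exists A : (K * K)%type -> (K * K)%type,
    affine_permutation A /\
    (forall w, graph g w <-> exists2 v, graph f v & w = A v).

(* Main.v *)
Require Import Defs.
From HB Require Import structures.
From mathcomp Require Import all_boot all_order all_fingroup all_algebra all_field.
From mathcomp Require Import ring zify.

(** Write [n = 2 * k], [q = 2 ^ r], [g x = x ^+ (q + 1)] and let a bar denote the
    power [2 ^ k], so that [f x = T x + c * N x], where [N x] is the norm of [x]
    to [L] and [T] takes values in [L]. Both [f] and [g] are quadratic: their
    second differences [B x y] and [B_g x y] are biadditive.

    The first step shows that a CCZ-equivalence from [f] to [g] preserves the
    vertical subspace [{0} * K]. A functional on [K * K] restricts to a Boolean
    function on each graph, and the square of its character sum is an invariant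
    of the equivalence. For a quadratic function this square equals the order
    of [K] exactly when the polar form of the restriction is nondegenerate
    ([flat_quadratic]), which depends only on the functional on [{0} * K]. If
    the equivalence moved [{0} * K], the set of functionals [beta] of [K] for
    which [beta \o g] is nondegenerate would be invariant under translation by
    a nonzero functional. For the Gold function this is impossible
    ([gold_nondeg_rigid]): up to scaling, the degenerate functionals correspond
    to the values of [g], and these would form an additive group, which contains
    all [x ^+ q + x], half of the field, while there are only
    [(2 ^ n + 2) / 3] values of [g].

    Hence the polar forms are related by [B (p x) (p y) = Lam (B_g x y)] with [p]
    and [Lam] additive and [p] onto ([CCZ_gold_polar]). The second step looks only
    at the coordinate of [f] along [c]: the polar form of the norm, composed with
    [p], would be an additive function of [B_g x y = x ^+ q * y + x * y ^+ q].
    Expanding both sides in the monomials [x ^+ (q ^ t) * y ^+ (q ^ u)], with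
    exponents [t] and [u] modulo [n], yields a contradiction
    ([no_norm_projection]). *)

Set Implicit Arguments.
Unset Strict Implicit.
Unset Printing Implicit Defensive.

Import GRing.Theory Num.Theory.
Local Open Scope ring_scope.

(** * Character sums of quadratic forms over the field with two elements *)

Definition chi (a : 'F_2) : int := (-1) ^+ (a : nat).

Lemma chiD : {morph chi : a b / a + b >-> a * b}.
Proof. by case=> [[|[|?]] ?] [[|[|?]] ?]. Qed.

Lemma F2_addxx (a : 'F_2) : a + a = 0.
Proof. by case: a => [[|[|?]] ?] //; apply/val_inj. Qed.

Lemma chi_eq1 (a : 'F_2) : (chi a == 1) = (a == 0).
Proof. by case: a => [[|[|?]] ?]. Qed.

Lemma chi_cases (a : 'F_2) : chi a = 1 \/ chi a = -1.
Proof. by case: a => [[|[|?]] ?] //; [left | right]. Qed.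

(** The Walsh coefficient of [Q] at 0 has the absolute value that it takes
    everywhere when [Q] is bent. Unlike bentness itself, this depends only on
    how often [Q] takes each value, so it survives any reparametrisation of the
    domain, in particular the nonlinear one that a CCZ-equivalence induces. *)
Definition flat (V : finType) (Q : V -> 'F_2) : Prop :=
  (\sum_x chi (Q x)) ^+ 2 = #|V|%:R.

Section Quadratic.
Variables (V : finZmodType) (Q : V -> 'F_2) (B : V -> V -> 'F_2).
Hypothesis polar : forall x y, Q (x + y) = Q x + Q y + B x y.
Hypothesis addB : forall h, {morph B^~ h : x y / x + y}.

Lemma polar_sym x y : B x y = B y x.
Proof.
have := polar x y; rewrite addrC polar [Q y + _]addrC => /addrI.
by [].
Qed.

Definition radical : {set V} := [set h | [forall x, B x h == 0]].

Lemma radicalP h : reflect (forall x, B x h = 0) (h \in radical).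
Proof. by rewrite inE; apply/'forall_eqP. Qed.

Lemma sum_chi_additive h :
  \sum_x chi (B x h) = if h \in radical then #|V|%:R else 0.
Proof.
case: ifP => [/radicalP rad_h | /negbT].
  by under eq_bigr => x _ do rewrite rad_h; rewrite sumr_const.
rewrite inE negb_forall => /existsP[x0 Bx0].
set S := LHS; suff: S = - S by lia.
rewrite {1}/S (reindex_inj (addrI x0)) -[RHS]mulN1r /S mulr_sumr.
apply: eq_bigr => x _; rewrite addB chiD; congr (_ * _).
by have [/eqP|//] := chi_cases (B x0 h); rewrite chi_eq1 (negbTE Bx0).
Qed.

(** Substituting [y = x + h] in the double sum over [x, y] turns the summand
    into [chi (Q h) * chi (B x h)]; summing over [x] first leaves only the [h]
    in the radical. *)
Lemma sum_chi_sqr :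
  (\sum_x chi (Q x)) ^+ 2 = #|V|%:R * \sum_(h in radical) chi (Q h).
Proof.
rewrite expr2 mulr_suml.
under eq_bigr => x _.
  rewrite mulr_sumr (reindex_inj (addrI x)) /=.
  under eq_bigr => h _ do rewrite -chiD polar !addrA F2_addxx add0r chiD.
  over.
rewrite exchange_big /= mulr_sumr [RHS]big_mkcond /=; apply: eq_bigr => h _.
rewrite -mulr_sumr sum_chi_additive; case: ifP => _; last by rewrite mulr0.
by rewrite mulrC.
Qed.

Lemma radicalDr h h' : h' \in radical -> (h + h' \in radical) = (h \in radical).
Proof.
move/radicalP=> rad'; rewrite !inE; apply: eq_forallb => x.
by rewrite polar_sym addB ![B _ x]polar_sym rad' addr0.
Qed.

(** On the radical [Q] is additive, so the sum in [sum_chi_sqr] is 0 or the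
    order of the radical; it is 1 only for a trivial radical. The point is that
    the right-hand side sees only the polar form of [Q]: adding an additive
    function to [Q] does not change whether it is flat. *)
Lemma flat_quadratic : flat Q <-> (forall h, (forall x, B x h = 0) -> h = 0).
Proof.
have Vn0 : #|V|%:R != 0 :> int.
  by rewrite pnatr_eq0 -lt0n; apply/card_gt0P; exists 0.
have B0 h : B 0 h = 0 by apply: (addrI (B 0 h)); rewrite -addB !addr0.
have Q0 : Q 0 = 0 by have := polar 0 0; rewrite B0 !addr0 F2_addxx.
rewrite /flat sum_chi_sqr; split=> [eS|nondeg]; last first.
  rewrite (big_pred1 0) ?Q0 ?mulr1 // => h; apply/radicalP/eqP => [/nondeg //|->].
  by move=> x; rewrite polar_sym B0.
have {eS} S1 : \sum_(h in radical) chi (Q h) = 1.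
  by apply: (mulfI Vn0); rewrite mulr1.
move=> h /radicalP rad_h; apply: contra_eq S1 => h0.
have [/existsP[h1 /andP[rad1 Qh1]] | /existsPn allQ] :=
    boolP [exists h1, (h1 \in radical) && (Q h1 != 0)].
  (* translation by h1 flips the sign of every term *)
  set S := \sum_(_ in _) _; suff: S = - S by lia.
  rewrite {1}/S (reindex_inj (addIr h1)) -[RHS]mulN1r /S mulr_sumr.
  apply: eq_big => [x|x]; rewrite radicalDr // => rx.
  rewrite polar (radicalP _ rad1) addr0 chiD mulrC; congr (_ * _).
  by have [/eqP|//] := chi_cases (Q h1); rewrite chi_eq1 (negbTE Qh1).
rewrite (eq_bigr (fun _ => 1)) => [|x rx]; last first.
  by apply/eqP; rewrite chi_eq1; have := allQ x; rewrite rx negbK.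
rewrite sumr_const pnatr_eq1 neq_ltn; apply/orP; right; apply/card_gt1P.
by exists 0, h; rewrite // eq_sym; split=> //; apply/radicalP => x; rewrite polar_sym B0.
Qed.
End Quadratic.

(** * Gold functions on a field of even degree *)

Section EvenFiniteField.
Variables (F : finFieldType) (n r : nat).
Hypotheses (cardF : #|F| = (2 ^ n)%N) (co_rn : coprime r n).

Lemma pchar2_card : 2%N \in [pchar F].
Proof. exact: card_finPcharP cardF _. Qed.

Lemma exprD2n i (x y : F) :
  (x + y) ^+ (2 ^ i) = x ^+ (2 ^ i) + y ^+ (2 ^ i).
Proof. by rewrite exprDn_pchar // pnatX (pnatE _ (isT : prime 2)) pchar2_card. Qed.

Lemma expf2_period i (x : F) : x ^+ (2 ^ (i * n)) = x.
Proof.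
by elim: i => [|i IHi]; rewrite ?expr1 // mulSn expnD exprM -cardF expf_card.
Qed.

(** A power of [x |-> x ^+ (2 ^ r)] is the squaring map, by a Bezout relation
    between [r] and [n]. *)
Lemma fixed_frobenius (x : F) : x ^+ (2 ^ r) = x -> x = 0 \/ x = 1.
Proof.
suff : (x ^+ (2 ^ r) = x -> x ^+ 2 = x).
  move=> sq /sq/eqP; rewrite -subr_eq0 expr2 -[X in _ - X]mulr1 -mulrBr.
  by rewrite mulf_eq0 subr_eq0 => /orP[] /eqP; [left | right].
case: (posnP r) co_rn => [->|r_gt0 /(coprimeP _ r_gt0)[[u v] /= uv] xq].
  by rewrite /coprime gcd0n => /eqP n1 _; rewrite -[RHS]expf_card cardF n1.
have uq i : x ^+ (2 ^ (i * r)) = x.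
  by elim: i => [|i IHi]; rewrite ?expr1 // mulSn expnD exprM xq.
have := uq u; have -> : (u * r = v * n + 1)%N by lia.
by rewrite expnD exprM expf2_period.
Qed.

(** The map is additive with kernel [{0, 1}], so its fibres have at most two
    points. *)
Lemma leq_card_hyperplane :
  (#|F| <= 2 * #|[set (x ^+ (2 ^ r) + x)%R | x : F]|)%N.
Proof.
pose phi (x : F) := x ^+ (2 ^ r) + x.
rewrite -[leqLHS]sum1_card (partition_big phi [in [set phi x | x : F]]) /=; last first.
  by move=> x _; apply: imset_f.
rewrite mulnC -sum_nat_const; apply: leq_sum => _ /imsetP[x _ ->].
rewrite sum1_card; apply: leq_trans (_ : #|[set x; (x + 1)%R]| <= 2)%N.
  apply/subset_leq_card/subsetP => y; rewrite !inE /= => /eqP.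
  rewrite /phi => exy; have : (y - x) ^+ (2 ^ r) = y - x.
    have c2 : 2%:R = 0 :> F by apply: pcharf0; exact: pchar2_card.
    rewrite oppr_pchar2 ?pchar2_card // exprD2n.
    have -> : y ^+ (2 ^ r) = x ^+ (2 ^ r) + x + y.
      by rewrite -exy -addrA addrr_pchar2 ?addr0 ?pchar2_card.
    by move: (x ^+ (2 ^ r)) => t; ring: c2.
  case/fixed_frobenius => /eqP; rewrite subr_eq => /eqP ->.
    by rewrite add0r eqxx.
  by rewrite addrC eqxx orbT.
by rewrite cards2; case: eqP.
Qed.

(** The exponent [2 ^ r + 1] and the order [2 ^ n - 1] of the unit group are
    both multiples of 3, so the values [x ^+ (2 ^ r + 1)] are cubes, and a
    nonzero cube is a root of unity of order dividing [(2 ^ n - 1) / 3]. With 0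
    included, they are all roots of ['X^m - 'X] for [m = (2 ^ n + 2) / 3]. *)
Lemma card_gold_image :
  odd r -> ~~ odd n -> (3 * #|[set (x ^+ (2 ^ r + 1))%R | x : F]| <= 2 ^ n + 2)%N.
Proof.
move=> odd_r even_n.
have mod3 i : (2 ^ i = (if odd i then 2 else 1) %[mod 3])%N.
  elim: i => // i IHi; rewrite expnS -modnMmr IHi /=.
  by case: (odd i).
have /dvdnP[j Ej] : (3 %| 2 ^ r + 1)%N by rewrite /dvdn -modnDml mod3 odd_r.
have /dvdnP[m Em] : (3 %| 2 ^ n + 2)%N.
  by rewrite /dvdn -modnDml mod3 (negbTE even_n).
have m_gt1 : (1 < m)%N.
  have : (1 < #|F|)%N by exact: finNzRing_gt1.
  by rewrite cardF; lia.
set S := [set _ | x : F].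
suff : (#|S| < m.+1)%N by lia.
pose P : {poly F} := 'X^m - 'X.
have sizeP : size P = m.+1.
  by rewrite size_polyDl size_polyXn // size_polyN size_polyX.
rewrite -sizeP cardE max_poly_roots ?enum_uniq -?size_poly_eq0 ?sizeP //.
apply/allP => u; rewrite mem_enum => /imsetP[z _ ->{u}].
rewrite rootE !hornerE subr_eq0 Ej -exprM.
have -> : (j * 3 * m = (2 ^ n + 2) * j)%N by lia.
by rewrite [(j * 3)%N]mulnC !exprM exprD -cardF expf_card -exprS.
Qed.

(** If the values [x ^+ (2 ^ r + 1)] were closed under addition, they would
    include all [x ^+ (2 ^ r) + x], the polarisation of this power at [x] and 1,
    hence half of the field. But they fill only about a third of it. *)
Lemma gold_image_not_additive : odd r -> ~~ odd n -> (2 < n)%N ->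
  ~ (forall x y : F,
      exists z, x ^+ (2 ^ r + 1) + y ^+ (2 ^ r + 1) = z ^+ (2 ^ r + 1)).
Proof.
move=> odd_r even_n n_gt2 addS.
have sub : [set x ^+ (2 ^ r) + x | x : F]
             \subset [set x ^+ (2 ^ r + 1) | x : F].
  apply/subsetP => _ /imsetP[x _ ->].
  have [z Ez] := addS (x + 1) x; have [w Ew] := addS z 1.
  apply/imsetP; exists w => //; rewrite -Ew -Ez !exprD exprD2n !expr1 !expr1n.
  have c2 : 2%:R = 0 :> F by apply: pcharf0; exact: pchar2_card.
  by ring: c2.
have leF := leq_trans leq_card_hyperplane (leq_mul (leqnn 2) (subset_leq_card sub)).
have := card_gold_image odd_r even_n; move: leF.
rewrite cardF -(subnK n_gt2) expnD (_ : 2 ^ 3 = 8)%N //.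
have : (0 < 2 ^ (n - 3))%N by rewrite expn_gt0.
move: (2 ^ (n - 3))%N #|_| => *; lia.
Qed.

(** The polar form of [x |-> x ^+ (2 ^ r + 1)]. *)
Definition gold_polar (x h : F) : F :=
  x ^+ (2 ^ r) * h + x * h ^+ (2 ^ r).

(** For additive [beta] this says that the quadratic form
    [x |-> beta (x ^+ (2 ^ r + 1))] is nondegenerate, i.e. bent. *)
Definition gold_nondeg (beta : F -> 'F_2) : bool :=
  [forall h, [forall x, beta (gold_polar x h) == 0] ==> (h == 0)].

Lemma gold_nondegP beta :
  reflect (forall h, (forall x, beta (gold_polar x h) = 0) -> h = 0)
          (gold_nondeg beta).
Proof.
apply: (iffP forallP) => nd h; last by apply/implyP => /'forall_eqP/nd ->.
by move=> rad; apply/eqP/(implyP (nd h))/'forall_eqP.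
Qed.

Lemma gold_nondegPn beta :
  reflect (exists2 h, h != 0 & forall x, beta (gold_polar x h) = 0)
          (~~ gold_nondeg beta).
Proof.
rewrite negb_forall; apply: (iffP existsP) => -[h].
  by rewrite negb_imply => /andP[/'forall_eqP rad h0]; exists h.
by move=> h0 rad; exists h; rewrite negb_imply h0 andbT; apply/'forall_eqP.
Qed.

Lemma eq_gold_nondeg beta beta' :
  beta =1 beta' -> gold_nondeg beta = gold_nondeg beta'.
Proof.
by move=> e; apply: eq_forallb => h; congr (_ ==> _); apply: eq_forallb => x; rewrite e.
Qed.

Lemma gold_polarZ l x h :
  gold_polar (l * x) (l * h) = l ^+ (2 ^ r + 1) * gold_polar x h.
Proof. by rewrite /gold_polar !exprMn exprD expr1; ring. Qed.

(** Multiplication by [l] on the field rescales the Gold function, so the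
    functionals with a nondegenerate form are permuted by these scalings. *)
Lemma gold_nondegZ beta l : l != 0 ->
  gold_nondeg (fun y => beta (l ^+ (2 ^ r + 1) * y)) = gold_nondeg beta.
Proof.
move=> l0; apply/gold_nondegP/gold_nondegP => nd h rad; last first.
  have /eqP : l * h = 0.
    by apply: nd => x; rewrite -(mulVKf l0 x) gold_polarZ.
  by rewrite mulf_eq0 (negbTE l0) => /eqP.
have : l^-1 * h = 0.
  by apply: nd => x; rewrite -gold_polarZ (mulVKf l0).
by move/eqP; rewrite mulf_eq0 invr_eq0 (negbTE l0) => /eqP.
Qed.

Lemma frobenius_surj y : exists x : F, x ^+ (2 ^ r) = y.
Proof.
have inj : injective (fun x : F => x ^+ (2 ^ r)).
  move=> x x' /eqP; rewrite -subr_eq0 oppr_pchar2 ?pchar2_card // -exprD2n.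
  rewrite expf_eq0 => /andP[_].
  by rewrite addr_eq0 oppr_pchar2 ?pchar2_card // => /eqP.
by have [g _ gK] := injF_bij inj; exists (g y); apply: gK.
Qed.

(** Here [tau] is a stand-in for the absolute trace. Put
    [w = v * z ^+ (2 ^ r + 1)]; the hypothesis at [x = t * z] says
    [tau (w * t ^+ (2 ^ r)) = tau (w * t)], and invariance of [tau] turns the
    right-hand side into [tau (w ^+ (2 ^ r) * t ^+ (2 ^ r))]. As [tau] is
    nonzero, [w] is fixed by the Frobenius power, hence equal to 1. *)
Lemma frobenius_invariant_radical (tau : F -> 'F_2) (v z : F) :
  {morph tau : x y / x + y} -> (forall t, tau (t ^+ (2 ^ r)) = tau t) ->
  (exists y, tau y != 0) -> v != 0 -> z != 0 ->
  (forall x, tau (v * gold_polar x z) = 0) -> v * z ^+ (2 ^ r + 1) = 1.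
Proof.
move=> tauD tauF [y0 tau_y0] v0 z0 rad; set w := v * _.
have w0 : w != 0 by rewrite mulf_neq0 ?expf_neq0.
have tau_w t : tau ((w + w ^+ (2 ^ r)) * t ^+ (2 ^ r)) = 0.
  rewrite mulrDl tauD -exprMn tauF -tauD -(rad (t * z)); congr tau.
  by rewrite /gold_polar /w exprMn exprD expr1; ring.
have [/eqP|u0] := eqVneq (w + w ^+ (2 ^ r)) 0.
  rewrite addrC addr_eq0 oppr_pchar2 ?pchar2_card // => /eqP/fixed_frobenius.
  by case=> // w_eq0; rewrite w_eq0 eqxx in w0.
have [t Et] := frobenius_surj (y0 / (w + w ^+ (2 ^ r))).
by have := tau_w t; rewrite Et mulrC divfK // => /eqP; rewrite (negbTE tau_y0).
Qed.

(** Taking [beta = mu] shows that the form of [mu] itself is degenerate. If [mu]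
    is nonzero, a point of its radical exhibits [mu], up to scaling, as a
    Frobenius-invariant functional [tau], and the functionals [tau (v * _)] with
    degenerate form are those with [v] a value of [x |-> x ^+ (2 ^ r + 1)] (one
    inclusion is [frobenius_invariant_radical], the other comes from scaling).
    By scaling, translation by every such functional preserves degeneracy, so
    these values are closed under addition, against
    [gold_image_not_additive]. *)
Lemma gold_nondeg_rigid (mu : F -> 'F_2) :
  odd r -> ~~ odd n -> (2 < n)%N -> {morph mu : x y / x + y} ->
  (forall beta : F -> 'F_2, {morph beta : x y / x + y} ->
     gold_nondeg (beta \+ mu) = gold_nondeg beta) ->
  forall y, mu y = 0.
Proof.
move=> odd_r even_n n_gt2 muD inv_mu y; apply/eqP/negP => /negP mu_y.
have nd0 : ~~ gold_nondeg (fun=> 0).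
  by apply/gold_nondegPn; exists 1; rewrite ?oner_neq0.
have nd_mu : ~~ gold_nondeg mu.
  rewrite -inv_mu // (eq_gold_nondeg (beta' := fun=> 0)) // => x /=.
  exact: F2_addxx.
have [h h0 rad_h] := gold_nondegPn _ nd_mu.
have inv_mul l (beta : F -> 'F_2) : l != 0 -> {morph beta : x y / x + y} ->
    gold_nondeg (fun x => beta x + mu (l ^+ (2 ^ r + 1) * x)) = gold_nondeg beta.
  move=> l0 betaD; have lV0 : l^-1 != 0 by rewrite invr_eq0.
  rewrite -[RHS](gold_nondegZ _ lV0) -[RHS]inv_mu => [|x x']; last first.
    by rewrite mulrDr betaD.
  rewrite -[LHS](gold_nondegZ _ lV0); apply: eq_gold_nondeg => x /=.
  by rewrite exprVn mulVKf ?expf_neq0.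
pose tau x := mu (h ^+ (2 ^ r + 1) * x).
have tauD : {morph tau : x y / x + y} by move=> x x'; rewrite /tau mulrDr muD.
have tauF t : tau (t ^+ (2 ^ r)) = tau t.
  apply: (addIr (tau t)); rewrite F2_addxx -tauD -(rad_h (h * t)).
  by congr mu; rewrite /gold_polar exprMn exprD expr1; ring.
have tau_neq0 : exists x, tau x != 0.
  by exists ((h ^+ (2 ^ r + 1))^-1 * y); rewrite /tau mulVKf ?expf_neq0.
apply: (gold_image_not_additive odd_r even_n n_gt2) => x1 x2.
have E0 : 0 ^+ (2 ^ r + 1) = 0 :> F by rewrite addn1 exprS mul0r.
have [->|x1n0] := eqVneq x1 0; first by exists x2; rewrite E0 add0r.
have [->|x2n0] := eqVneq x2 0; first by exists x1; rewrite E0 addr0.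
set v := _ + _; have [->|v0] := eqVneq v 0; first by exists 0.
have : ~~ gold_nondeg (fun x => tau (v * x)).
  rewrite (eq_gold_nondeg (beta' := fun x =>
    mu ((h * x1) ^+ (2 ^ r + 1) * x) + mu ((h * x2) ^+ (2 ^ r + 1) * x))).
    rewrite inv_mul ?mulf_neq0 // => [|x x']; last by rewrite mulrDr muD.
    by rewrite gold_nondegZ ?mulf_neq0.
  by move=> x; rewrite /tau /v -muD !exprMn; congr mu; ring.
case/gold_nondegPn => z z0 rad_z.
have vz := frobenius_invariant_radical tauD tauF tau_neq0 v0 z0 rad_z.
exists z^-1; rewrite exprVn; apply: (mulIf (expf_neq0 (2 ^ r + 1) z0)).
by rewrite vz mulVf ?expf_neq0.
Qed.

(** Otherwise all [2 ^ n] elements would be roots of ['X^(2 ^ d) - 'X], where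
    [d < n] is the residue of [r * j] modulo [n], nonzero since [r] is prime
    to [n]. *)
Lemma frobenius_iter_neq_id j : (0 < j < n)%N ->
  exists z : F, z ^+ ((2 ^ r) ^ j) != z.
Proof.
move=> /andP[j_gt0 j_lt_n]; apply/existsP; apply: contraT; rewrite negb_exists.
move=> /forallP fixed; pose d := ((r * j) %% n)%N.
have n_gt0 : (0 < n)%N by apply: leq_trans j_lt_n.
have d_lt_n : (d < n)%N by rewrite ltn_mod.
have d_gt0 : (0 < d)%N.
  rewrite lt0n; apply/negP => /eqP d0; have : (n %| j)%N.
    by rewrite -(@Gauss_dvdr n r) 1?coprime_sym // /dvdn -/d d0.
  by move/(dvdn_leq j_gt0); rewrite leqNgt j_lt_n.
have dP (z : F) : z ^+ (2 ^ d) = z.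
  have := fixed z; rewrite negbK -expnM (divn_eq (r * j) n) expnD exprM.
  by rewrite expf2_period => /eqP.
pose P : {poly F} := 'X^(2 ^ d) - 'X.
have sizeP : size P = (2 ^ d).+1.
  rewrite size_polyDl size_polyXn // size_polyN size_polyX ltnS.
  by have := ltn_exp2l 0 d (isT : (1 < 2)%N); rewrite expn0 d_gt0.
suff : (#|F| < (2 ^ d).+1)%N by rewrite cardF ltnS leq_exp2l // leqNgt d_lt_n.
rewrite -sizeP cardE max_poly_roots ?enum_uniq -?size_poly_eq0 ?sizeP //.
by apply/allP => z _; rewrite rootE !hornerE dP subrr.
Qed.

(** Independence of the automorphisms [x |-> x ^+ ((2 ^ r) ^ t)]: comparing a
    relation at [z * x] with a multiple of the relation at [x] removes the last
    term, and some [z] keeps any other given term alive. *)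
Lemma frobenius_independent m (a : nat -> F) : (m <= n)%N ->
  (forall x, \sum_(t < m) a t * x ^+ ((2 ^ r) ^ t) = 0) ->
  forall t, (t < m)%N -> a t = 0.
Proof.
elim: m a => // m IHm a m_lt_n sum0.
have a0 t : (t < m)%N -> a t = 0.
  move=> t_lt_m; have /frobenius_iter_neq_id[z zP] : (0 < m - t < n)%N by lia.
  have zP' : z ^+ ((2 ^ r) ^ t) - z ^+ ((2 ^ r) ^ m) != 0.
    have -> : z ^+ ((2 ^ r) ^ m) = (z ^+ ((2 ^ r) ^ (m - t))) ^+ ((2 ^ r) ^ t).
      by rewrite -exprM -expnD subnK // ltnW.
    apply: contra zP; rewrite oppr_pchar2 ?pchar2_card // -expnM -exprD2n addrC.
    by rewrite expf_eq0 => /andP[_]; rewrite addr_eq0 oppr_pchar2 ?pchar2_card.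
  apply/eqP; rewrite -(mulIr_eq0 _ (mulIf zP')); apply/eqP.
  pose a' i := a i * (z ^+ ((2 ^ r) ^ i) - z ^+ ((2 ^ r) ^ m)).
  apply: (IHm a' (ltnW m_lt_n)) => // x.
  have := etrans (sum0 (z * x)) (esym (mulr0 (z ^+ ((2 ^ r) ^ m)))).
  rewrite -[X in _ = _ * X](sum0 x).
  rewrite !big_ord_recr /= mulrDr mulr_sumr exprMn.
  rewrite [X in _ = _ + X]mulrCA => /addIr/eqP; rewrite -subr_eq0
          -sumrB => /eqP E; rewrite -[RHS]E.
  by apply: eq_bigr => i _; rewrite /a' exprMn; ring.
move=> t; rewrite ltnS leq_eqVlt => /predU1P[->|/a0//].
have := sum0 1; rewrite big_ord_recr /= expr1n mulr1 big1 ?add0r // => i _.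
by rewrite a0 // mul0r.
Qed.

Lemma sum_expr2n (I : finType) i (G : I -> F) :
  (\sum_t G t) ^+ (2 ^ i) = \sum_t G t ^+ (2 ^ i).
Proof.
apply: (big_morph (fun x => x ^+ (2 ^ i)) (exprD2n i)).
by apply/eqP; rewrite expf_eq0 expn_gt0 eqxx.
Qed.
End EvenFiniteField.

(** * Linearized polynomials with exponents in a cyclic group *)

Section CyclicExponents.
Variables (F : finFieldType) (N k r : nat).
Hypotheses (cardF : #|F| = (2 ^ N.+1)%N) (co_rn : coprime r N.+1).
Hypotheses (Nk : N.+1 = (2 * k)%N) (odd_r : odd r) (odd_k : odd k).
Hypothesis k_gt1 : (1 < k)%N.

Local Notation I := 'I_N.+1.
Local Notation Fr x t := (x ^+ ((2 ^ r) ^ nat_of_ord t)).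

(** Since [2 ^ r] generates the same automorphisms as 2, linearized polynomials
    can be written with the exponents [(2 ^ r) ^ t]. Indexing them by the cyclic
    group ['I_N.+1] makes raising to the power [2 ^ r] a shift by one, and the
    monomials of the Gold polar form those with indices [t] and [t + 1]. *)
Definition linearized (a : I -> F) (x : F) : F := \sum_t a t * Fr x t.

Lemma linearized_inj (a : I -> F) :
  (forall x, linearized a x = 0) -> forall t, a t = 0.
Proof.
move=> a0 t; rewrite -[t]inord_val.
apply: (frobenius_independent cardF co_rn (a := fun i => a (inord i)) (leqnn _)) => // x.
by rewrite -[RHS](a0 x); apply: eq_bigr => i _; rewrite inord_val.
Qed.

Lemma linearized_ext (a a' : I -> F) : linearized a =1 linearized a' -> a =1 a'.
Proof.
move=> e t; apply/eqP; rewrite -subr_eq0; apply/eqP; move: t.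
apply: linearized_inj => x; rewrite /linearized.
under eq_bigr do rewrite mulrBl.
by rewrite sumrB [X in X - _]e subrr.
Qed.

Lemma frobenius_shift j (x : F) (t : I) :
  Fr x t ^+ ((2 ^ r) ^ j) = Fr x (t + inZp j).
Proof.
rewrite -exprM -expnD /= modnDmr [in LHS](divn_eq (t + j) N.+1) -!expnM.
rewrite [in LHS]mulnC mulnDl addnC expnD exprM [in LHS]mulnC.
by rewrite mulnAC (expf2_period cardF).
Qed.

(** The two automorphisms agree because [r * k] is congruent to [k] modulo
    [2 * k] for odd [r]. *)
Lemma frobenius_half (x : F) : x ^+ (2 ^ k) = x ^+ ((2 ^ r) ^ k).
Proof.
rewrite -expnM; have -> : (r * k = k + r./2 * N.+1)%N.
  by rewrite -{1}(odd_double_half r) odd_r Nk; lia.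
by rewrite expnD exprM (expf2_period cardF).
Qed.

Lemma half_period : inZp k + inZp k = 0 :> I.
Proof. by apply/val_inj; rewrite /= modnDm addnn -mul2n -Nk modnn. Qed.

Lemma linearized_conj (a : I -> F) x :
  linearized a x ^+ (2 ^ k) = linearized (fun t => a (t + inZp k) ^+ (2 ^ k)) x.
Proof.
rewrite /linearized (sum_expr2n cardF) [RHS](reindex_inj (addIr (inZp k))) /=.
apply: eq_bigr => t _; rewrite -addrA half_period addr0 exprMn; congr (_ * _).
by rewrite frobenius_half frobenius_shift.
Qed.

(** The norm [y |-> y ^+ (2 ^ k + 1)] is not linearly equivalent to a linear
    image of the Gold function. Let [a t] be the coefficients of the bijection
    applied to the argument, [d t] those of its conjugate, and [D t u] the
    determinant of the vectors [(a t, d t)] and [(a u, d u)]. The right-hand side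
    of the second hypothesis has the coefficient [D t u] at the monomial with
    indices [t, u], while the left-hand side has only monomials with [t] and [u]
    adjacent in the cycle. So non-adjacent vectors are parallel. Some adjacent
    pair [t, t + 1] is independent, for the norm form does not vanish. The vector
    with the opposite index [t + k] is adjacent to neither of them, as [k] is
    odd and greater than 1, so it is parallel to both and must vanish; but it is
    the conjugate, with coordinates exchanged, of the nonzero vector with
    index [t]. *)
Lemma no_norm_projection (a e : I -> F) :
  (forall y, exists x, linearized a x = y) ->
  (forall x y, linearized e (gold_polar r x y) =
     linearized a x * linearized a y ^+ (2 ^ k)
     + linearized a x ^+ (2 ^ k) * linearized a y) ->
  False.
Proof.
move=> a_surj eN; pose d t := a (t + inZp k) ^+ (2 ^ k).
pose D t u := a t * d u + d t * a u.
have c2 := pchar2_card cardF.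
have conjA x : linearized a x ^+ (2 ^ k) = linearized d x by rewrite linearized_conj.
have DE t y : a t * linearized d y + d t * linearized a y = linearized (D t) y.
  rewrite /linearized !mulr_sumr -big_split; apply: eq_bigr => u _ /=.
  by rewrite /D; ring.
have normE x y : linearized a x * linearized a y ^+ (2 ^ k)
    + linearized a x ^+ (2 ^ k) * linearized a y
    = linearized (fun t => linearized (D t) y) x.
  rewrite !conjA {1 3}/linearized !mulr_suml -big_split; apply: eq_bigr => t _ /=.
  by rewrite -DE; ring.
have goldE x y : linearized e (gold_polar r x y)
    = linearized (fun t => e (t - inZp 1%N) * Fr y (t - inZp 1%N)
                           + e t * Fr y (t + inZp 1%N)) x.
  rewrite /linearized /gold_polar.
  have shift1 (z : F) (t : I) :
      (z ^+ (2 ^ r)) ^+ ((2 ^ r) ^ nat_of_ord t) = Fr z (t + inZp 1%N).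
    by rewrite -(frobenius_shift 1) expn1 -!exprM mulnC.
  transitivity (\sum_t (e t * Fr x (t + inZp 1%N) * Fr y t
                        + e t * Fr x t * Fr y (t + inZp 1%N))).
    apply: eq_bigr => t _; rewrite -expnM (exprD2n cardF) !exprMn !expnM !shift1; ring.
  rewrite big_split (reindex_inj (addIr (- inZp 1%N))) -big_split.
  by apply: eq_bigr => t _; rewrite subrK -[LHS]/(_ + _); ring.
pose c t u := (if u == t - inZp 1%N then e (t - inZp 1%N) else 0)
              + (if u == t + inZp 1%N then e t else 0).
have cE t y : linearized (c t) y
    = e (t - inZp 1%N) * Fr y (t - inZp 1%N) + e t * Fr y (t + inZp 1%N).
  rewrite /linearized /c; under eq_bigr do rewrite mulrDl.
  rewrite big_split -[LHS]/(_ + _); congr (_ + _).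
    rewrite (bigD1 (t - inZp 1%N)) // eqxx big1 => [|u /negbTE ->].
      exact: addr0.
    by rewrite mul0r.
  rewrite (bigD1 (t + inZp 1%N)) // eqxx big1 => [|u /negbTE ->].
    exact: addr0.
  by rewrite mul0r.
have Dc t : D t =1 c t.
  apply: linearized_ext => y; rewrite cE; move: t; apply: linearized_ext => x.
  by rewrite -normE -eN goldE.
(* determinants of non-adjacent vectors vanish *)
have D0 t u : u != t - inZp 1%N -> u != t + inZp 1%N -> D t u = 0.
  by move=> u1 u2; rewrite Dc /c (negbTE u1) (negbTE u2) addr0.
have symD t u : D t u = D u t by rewrite /D addrC; congr (_ + _); rewrite mulrC.
(* some adjacent pair is independent *)
have [t Dt] : exists t, D t (t + inZp 1%N) != 0.
  apply/existsP; apply: contraT; rewrite negb_exists => /forallP allD.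
  have D00 t u : D t u = 0.
    have [->|u1] := eqVneq u (t - inZp 1%N).
      rewrite symD; apply/eqP; have := allD (t - inZp 1%N).
      by rewrite subrK negbK.
    have [->|u2] := eqVneq u (t + inZp 1%N); last exact: D0.
    by apply/eqP; have := allD t; rewrite negbK.
  have [z] := frobenius_iter_neq_id cardF co_rn (j := k) ltac:(lia).
  rewrite -frobenius_half; have [x Ex] := a_surj 1; have [y <-] := a_surj z.
  have := normE x y; rewrite Ex expr1n !mul1r {3}/linearized big1 => [|t _].
    by move/eqP; rewrite addr_eq0 oppr_pchar2 // => ->.
  rewrite /linearized big1 ?mul0r // => u _; by rewrite D00 mul0r.
pose u := t + inZp k; pose s := t + inZp 1%N.
have neqI i j : (i < N.+1)%N -> (j < N.+1)%N -> i != j -> inZp i != inZp j :> I.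
  by move=> iN jN; apply: contraNneq => /(congr1 val) /=; rewrite !modn_small // => ->.
have opp1 : - inZp 1%N = inZp N :> I.
  apply/esym/eqP; rewrite -addr_eq0; apply/eqP/val_inj => /=.
  by rewrite modnDm addn1 modnn.
have two : inZp 1%N + inZp 1%N = inZp 2%N :> I.
  by apply/val_inj; rewrite /= modnDm.
have Dtu : D t u = 0.
  by apply: D0; rewrite /u (inj_eq (addrI t)) ?opp1; apply: neqI; lia.
have Dsu : D s u = 0.
  apply: D0; rewrite /u /s -addrA (inj_eq (addrI t)) ?two ?subrr.
    by rewrite (_ : 0 = inZp 0%N); [apply: neqI; lia | exact/val_inj].
  by apply: neqI; lia.
(* a vector parallel to two independent ones is zero, by Cramer's rule *)
have au : a u = 0.
  apply: (mulIf Dt); rewrite mul0r -/s.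
  transitivity (a s * D t u + a t * D s u); last by rewrite Dtu Dsu !mulr0 addr0.
  rewrite /D; have c2' := pcharf0 c2; ring: c2'.
have du : d u = 0.
  apply: (mulIf Dt); rewrite mul0r -/s.
  transitivity (d s * D t u + d t * D s u); last by rewrite Dtu Dsu !mulr0 addr0.
  rewrite /D; have c2' := pcharf0 c2; ring: c2'.
move: Dt; rewrite /D /d -/u au; move: du; rewrite /d /u -addrA half_period addr0.
move/eqP; rewrite expf_eq0 expn_gt0 /= => /eqP ->.
have -> : 0 ^+ (2 ^ k) = 0 :> F by apply/eqP; rewrite expf_eq0 expn_gt0 eqxx.
by rewrite !mul0r addr0 eqxx.
Qed.
End CyclicExponents.

(** * Additive functions on the field *)

Section Vectors.
Variable K : fieldExtType 'F_2.
Local Notation F := (finvect_type K).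

Lemma card_finvect : #|F| = (2 ^ \dim {:K})%N.
Proof. by rewrite -(@card_vspacef _ _ (Vector.class F)) card_vspace card_Fp. Qed.

Lemma coord_separates (x : K) :
  (forall rho : K -> 'F_2, {morph rho : y z / y + z} -> rho x = 0) -> x = 0.
Proof.
move=> rho0; rewrite (coord_vbasis (memvf x)) big1 // => i _.
by rewrite rho0 ?scale0r // => y z; apply: linearD.
Qed.

Lemma additive_eq_on_basis (p p' : K -> K) :
  {morph p : x y / x + y} -> {morph p' : x y / x + y} ->
  (forall i : 'I_(\dim {:K}), p (vbasis {:K})`_i = p' (vbasis {:K})`_i) ->
  p =1 p'.
Proof.
have add0 (g : K -> K) : {morph g : x y / x + y} -> g 0 = 0.
  by move=> gD; apply: (addrI (g 0)); rewrite -gD !addr0.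
have addZ (g : K -> K) (c : 'F_2) x : {morph g : x y / x + y} -> g (c *: x) = c *: g x.
  move=> gD; rewrite -[c]natr_Zp !scaler_nat.
  by elim: (val c) => [|m IHm]; rewrite ?mulr0n ?add0 // !mulrS gD IHm.
move=> pD p'D e x; rewrite (coord_vbasis (memvf x)).
rewrite (big_morph p pD (add0 _ pD)) (big_morph p' p'D (add0 _ p'D)).
by apply: eq_bigr => i _; rewrite !addZ // e.
Qed.

(** Evaluation on a basis embeds the coefficient vectors into a set of the same
    finite cardinality, so every choice of values on the basis is attained. *)
Lemma linearized_exists N r (p : K -> K) : \dim {:K} = N.+1 -> coprime r N.+1 ->
  {morph p : x y / x + y} ->
  exists a : 'I_N.+1 -> F, forall x, p x = linearized r a x.
Proof.
move=> dimK co_rn pD.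
have cardF : #|F| = (2 ^ N.+1)%N by rewrite card_finvect dimK.
have linD (a : 'I_N.+1 -> F) : {morph linearized r a : x y / x + y}.
  move=> x y; rewrite /linearized -big_split; apply: eq_bigr => t _.
  by rewrite -expnM (exprD2n cardF) mulrDr.
pose ev (a : {ffun 'I_N.+1 -> F}) : {ffun 'I_(\dim {:K}) -> F} :=
  [ffun i : 'I_(\dim {:K}) => linearized r a (vbasis {:K})`_i].
have ev_inj : injective ev.
  move=> a a' /ffunP e; apply/ffunP; apply: (linearized_ext cardF co_rn).
  apply: (additive_eq_on_basis (linD a) (linD a')) => i.
  by have := e i; rewrite !ffunE.
pose w : {ffun 'I_(\dim {:K}) -> F} := [ffun i : 'I_(\dim {:K}) => p (vbasis {:K})`_i].
have /codomP[a /ffunP e] : w \in codom ev.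
  by apply: inj_card_onto => //; rewrite !card_ffun !card_ord dimK.
exists a; apply: (additive_eq_on_basis pD (linD a)) => i.
by have := e i; rewrite !ffunE.
Qed.
End Vectors.

(** * CCZ-equivalence and functionals on the graph *)

Section GraphFunctionals.
Variable K : fieldExtType 'F_2.
Local Notation F := (finvect_type K).

(** Whether a functional is flat on the graph of a quadratic function depends
    only on its restriction to the vertical subspace [{0} * K]. *)
Lemma flat_graph (f : K -> K) (B : K -> K -> K) (phi : K * K -> 'F_2) :
  (forall x y, f (x + y) = f x + f y + B x y) ->
  (forall h, {morph B^~ h : x y / x + y}) ->
  {morph phi : u v / u + v} ->
  flat (fun x : F => phi (x, f x)) <->
  (forall h, (forall x, phi (0, B x h) = 0) -> h = 0).
Proof.
move=> polar addB phiD.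
apply: (@flat_quadratic F (fun x => phi (x, f x)) (fun x h => phi (0, B x h))).
  by move=> x y; rewrite polar -!phiD /GRing.add /= /add_pair /= addr0.
by move=> h x y /=; rewrite addB -phiD /GRing.add /= /add_pair /= addr0.
Qed.

(** The first coordinate of [A (x, f x)] is a permutation of the field that
    matches the points of the two graphs, so both sums run over the same values
    up to the constant [phi a]. *)
Lemma affine_graph_flat (f g : K -> K) (A : K * K -> K * K)
    (l : 'End((K * K)%type)) a (phi : K * K -> 'F_2) :
  injective A -> (forall v, A v = l v + a) ->
  (forall w, graph g w <-> exists2 v, graph f v & w = A v) ->
  {morph phi : u v / u + v} ->
  flat (fun x : F => phi (x, g x)) <-> flat (fun x : F => phi (l (x, f x))).
Proof.
move=> injA Al Agraph phiD.
pose s (x : F) : F := (A (x, f x)).1.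
have As x : A (x, f x) = (s x, g (s x)).
  have [|x' Ex'] := (Agraph (A (x, f x))).2; first by exists (x, f x) => //; exists x.
  by rewrite /s Ex'.
have s_inj : injective s.
  by move=> x y sxy; have := As x; rewrite sxy -As => /injA[].
rewrite /flat (reindex_inj s_inj) /=.
under eq_bigr => x _ do rewrite -As Al phiD chiD.
rewrite -mulr_suml exprMn.
suff -> : chi (phi a) ^+ 2 = 1 by rewrite mulr1.
by have [->|->] := chi_cases (phi a); rewrite ?expr1n ?sqrrN ?expr1n.
Qed.
End GraphFunctionals.

Section Gold.
Variable K : fieldExtType 'F_2.
Local Notation F := (finvect_type K).

Lemma gold_polarP n r (x y : F) : #|F| = (2 ^ n)%N ->
  (x + y) ^+ (2 ^ r + 1)
  = x ^+ (2 ^ r + 1) + y ^+ (2 ^ r + 1) + gold_polar r x y.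
Proof. by move=> cardF; rewrite /gold_polar !exprD !expr1 (exprD2n cardF); ring. Qed.

Lemma gold_polarDl n r (h : F) : #|F| = (2 ^ n)%N ->
  {morph (fun x : F => gold_polar r x h) : x y / x + y}.
Proof. by move=> cardF x y; rewrite /gold_polar (exprD2n cardF); ring. Qed.

(** A CCZ-equivalence between a quadratic function and a Gold function is an
    extended affine equivalence. Let [m] be the inverse of the linear part. For
    every functional [rho] on the field, adding [rho] of the first coordinate to
    a functional changes nothing on the vertical subspace, hence nothing as to
    flatness on the graph of [f]. On the side of the Gold function, the same
    change adds [mu y = rho (m (0, y)).1] on the vertical subspace. By
    [gold_nondeg_rigid] this [mu] vanishes; so [m] preserves the vertical
    subspace, and taking second differences along the graphs gives the
    relation between the polar forms. *)
Lemma CCZ_gold_polar (r n : nat) (f : K -> K) (B : K -> K -> K) :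
  \dim {:K} = n -> coprime r n -> odd r -> ~~ odd n -> (2 < n)%N ->
  (forall x y, f (x + y) = f x + f y + B x y) ->
  (forall h, {morph B^~ h : x y / x + y}) ->
  CCZ_equivalent f (fun x : K => x ^+ (2 ^ r + 1)) ->
  exists p Lam : K -> K,
    [/\ {morph p : x y / x + y}, {morph Lam : x y / x + y},
        (forall y, exists x, p x = y)
      & forall x y : F, B (p x) (p y) = Lam (gold_polar r x y)].
Proof.
move=> dimK co_rn odd_r even_n n_gt2 polar addB [A [[[Ainv AK _] [l [a Al]]] Agraph]].
have cardF : #|F| = (2 ^ n)%N by rewrite card_finvect dimK.
have injA := can_inj AK.
have ker_l : lker l == 0%VS.
  by apply/lker0P => u v luv; apply: injA; rewrite !Al luv.
pose m : 'End((K * K)%type) := (l^-1)%VF.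
have lK : cancel l m := lker0_lfunK ker_l.
have mK : cancel m l := lker0_lfunVK ker_l.
pose g (x : K) : K := x ^+ (2 ^ r + 1).
have flat_g phi : {morph phi : u v / u + v} ->
    flat (fun x : F => phi (x, g x)) <-> gold_nondeg r (fun y : F => phi (0, y)).
  move=> phiD; split.
    move/(flat_graph (B := fun x y : F => gold_polar r x y)
           (fun x y => gold_polarP r x y cardF) (fun h => gold_polarDl r h cardF) phiD).
    by move=> nd; apply/gold_nondegP.
  move/gold_nondegP => nd.
  exact/(flat_graph (B := fun x y : F => gold_polar r x y)
           (fun x y => gold_polarP r x y cardF) (fun h => gold_polarDl r h cardF) phiD).
have pairD (x x' y y' : K) : (x + x', y + y') = (x, y) + (x', y') :> K * K by [].
have m_vert y : (m (0, y)).1 = 0.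
  apply: coord_separates => rho rhoD.
  move: y; apply: (@gold_nondeg_rigid F n r cardF co_rn (fun y => rho (m (0, y)).1)) => //.
    by move=> x y; rewrite -rhoD -[in LHS](addr0 0) pairD linearD.
  move=> beta betaD.
  pose th (u : K * K) := beta u.2.
  pose ph (u : K * K) := beta u.2 + rho (m u).1.
  have thD : {morph th : u v / u + v} by move=> u v; apply: betaD.
  have phD : {morph ph : u v / u + v}.
    move=> u v; by rewrite /ph !linearD betaD rhoD addrACA.
  have lD (phi : K * K -> 'F_2) : {morph phi : u v / u + v} ->
      {morph phi \o l : u v / u + v}.
    by move=> phiD u v /=; rewrite linearD phiD.
  have transfer phi : {morph phi : u v / u + v} ->
      gold_nondeg r (fun y : F => phi (0, y))
      <-> forall h, (forall x, phi (l (0, B x h)) = 0) -> h = 0.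
    move=> phiD; split.
      by move/(flat_g phi phiD)/(affine_graph_flat injA Al Agraph phiD)
           /(flat_graph polar addB (lD _ phiD)).
    by move/(flat_graph polar addB (lD _ phiD))
           /(affine_graph_flat injA Al Agraph phiD)/(flat_g phi phiD).
  apply/idP/idP.
    move/(transfer ph phD) => nd; apply/(transfer th thD) => h rad; apply: nd => x.
    rewrite /ph lK /= (_ : rho 0 = 0) ?addr0; first exact: rad.
    by apply: (addrI (rho 0)); rewrite -rhoD !addr0.
  move/(transfer th thD) => nd; apply/(transfer ph phD) => h rad; apply: nd => x.
  have := rad x; rewrite /ph lK /= (_ : rho 0 = 0) ?addr0 //.
  by apply: (addrI (rho 0)); rewrite -rhoD !addr0.
pose p x := (m (x, 0)).1; pose C x := (m (x, 0)).2; pose Lam y := (m (0, y)).2.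
have pD : {morph p : x y / x + y}.
  by move=> x y; rewrite /p -[in LHS](addr0 0) pairD linearD.
have CD : {morph C : x y / x + y}.
  by move=> x y; rewrite /C -[in LHS](addr0 0) pairD linearD.
have LD : {morph Lam : x y / x + y}.
  by move=> x y; rewrite /Lam -[in LHS](addr0 0) pairD linearD.
have mE x y : m (x, y) = (p x, C x + Lam y).
  rewrite -[x in LHS]addr0 -[y in LHS]add0r pairD linearD.
  rewrite -[LHS]/((m (x, 0)).1 + (m (0, y)).1, (m (x, 0)).2 + (m (0, y)).2).
  by rewrite m_vert addr0.
exists p, Lam; split=> //.
  move=> y; exists (l (y, 0)).1; have := lK (y, 0).
  by rewrite [l _]surjective_pairing mE => -[].
have fg x : f (p x - (m a).1) = C x + Lam (g x) - (m a).2.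
  have [_ [z ->] /esym Ez] := (Agraph (x, g x)).1 (ex_intro _ x erefl).
  move: Ez; rewrite Al => /(canRL (addrK a))/(congr1 m).
  rewrite lK linearB /= mE -[_ - m a]/(p x - (m a).1, C x + Lam (g x) - (m a).2).
  by case=> <- <-.
pose d := - (m a).1; pose kap := - (m a).2 - f d.
(* f o p is Lam o g up to an additive function and a constant *)
have fpE x : f (p x) = C x + Lam (g x) - B (p x) d + kap.
  have := fg x; rewrite polar -/d => /(canRL (addrK _))/(canRL (addrK _)) ->.
  by rewrite /kap; ring.
have add0 (h : K -> K) : {morph h : x y / x + y} -> h 0 = 0.
  by move=> hD; apply: (addrI (h 0)); rewrite -hD !addr0.
have B0 h : B 0 h = 0 by apply: (add0 (B^~ h)).
have f0 : f 0 = 0.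
  by apply: (addrI (f 0)); have := polar 0 0; rewrite B0 !addr0.
have kap0 : kap = 0.
  have := fpE 0; rewrite (add0 p) // (add0 C) // B0 f0 /g addn1 exprS mul0r.
  by rewrite (add0 Lam) // !addr0 subr0 add0r.
move=> x y; have := fpE (x + y); rewrite pD polar !fpE kap0 !addr0.
have gE : g (x + y) = g x + g y + gold_polar r x y := gold_polarP r x y cardF.
rewrite CD addB gE !LD => E.
apply: (addrI (C x + Lam (g x) - B (p x) d + (C y + Lam (g y) - B (p y) d))).
by rewrite E /g; ring.
Qed.
End Gold.

(** * The norm family *)

(* The field K is F_(2^(2k)) and L is its subfield F_(2^k). The hypothesis
   1 < k excludes only k = 1, since k is odd: for k = 1 one has
   f x = (1 + c) * x ^+ 3 on F_4, which is CCZ-equivalent to x ^+ 3. *)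
Theorem corollary3 (k s : nat) (k_odd : odd k) (s_odd : odd s)
    (k_s_coprime : coprime k s) (k_gt1 : (1 < k)%N)
    (K : fieldExtType 'F_2) (dimK : \dim {:K} = (2 * k)%N)
    (L : {subfield K}) (dimL : \dim L = k)
    (b : K) (b_prim : primitive_element b)
    (c : K) (c_notin_L : c \notin L)
    (r : nat) (r_gt0 : (0 < r)%N) (r_coprime : gcdn r (2 * k) = 1%N) :
  ~ CCZ_equivalent
      (fun x : K => b * x ^+ (2 ^ s + 1)
                    + (b * x ^+ (2 ^ s + 1)) ^+ (2 ^ k)
                    + c * x ^+ (2 ^ k + 1))
      (fun x : K => x ^+ (2 ^ r + 1)).
Proof.
set f := fun x : K => b * _ + _ + _ => ccz.
have cardF : #|finvect_type K| = (2 ^ (2 * k))%N by rewrite card_finvect dimK.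
have addX i (x y : K) : (x + y) ^+ (2 ^ i) = x ^+ (2 ^ i) + y ^+ (2 ^ i).
  exact: (exprD2n cardF).
have c2 : 2%N \in [pchar K] := pchar2_card cardF.
have c2' : 2%:R = 0 :> K := pcharf0 c2.
have conjK (x : K) : (x ^+ (2 ^ k)) ^+ (2 ^ k) = x.
  rewrite -exprM -expnD addnn -mul2n.
  by have := expf2_period cardF 1 (x : finvect_type K); rewrite mul1n.
pose G i (x y : K) : K := x ^+ (2 ^ i) * y + x * y ^+ (2 ^ i).
pose B x y := b * G s x y + (b * G s x y) ^+ (2 ^ k) + c * G k x y.
have GD i (h : K) : {morph G i ^~ h : x y / x + y}.
  by move=> x y; rewrite /G addX; ring.
have powD i (x y : K) : (x + y) ^+ (2 ^ i + 1)
    = x ^+ (2 ^ i + 1) + y ^+ (2 ^ i + 1) + G i x y.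
  exact: (gold_polarP _ _ _ cardF).
have polar x y : f (x + y) = f x + f y + B x y.
  by rewrite /f /B !powD !mulrDr !addX; ring.
have addB h : {morph B^~ h : x y / x + y}.
  by move=> x y; rewrite /B !GD !mulrDr !addX; ring.
have odd_r : odd r.
  apply: contra_eqT r_coprime => even_r; rewrite gtn_eqF //.
  suff : (2 %| gcdn r (2 * k))%N by apply: dvdn_leq; rewrite gcdn_gt0 r_gt0.
  by rewrite dvdn_gcd dvdn2 even_r dvdn_mulr.
have co_rn : coprime r (2 * k) by rewrite /coprime r_coprime.
have [||p [Lam [pD LD p_surj pB]]] :=
    CCZ_gold_polar dimK co_rn odd_r _ _ polar addB ccz.
- by rewrite oddM.
- lia.
pose cc := c + c ^+ (2 ^ k).
have cc0 : cc != 0.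
  apply: contraNneq c_notin_L => /eqP; rewrite addr_eq0 oppr_pchar2 // => /eqP cE.
  by rewrite Fermat's_little_theorem dimL card_Fp // -cE.
(* pi kills the subfield fixed by conjugation and maps c * t to t there, so
   it extracts the coordinate of f along c, which is the norm. *)
pose pi z := (z + z ^+ (2 ^ k)) / cc.
have piD : {morph pi : x y / x + y} by move=> x y; rewrite /pi addX; ring.
have piB x y : pi (B x y) = x * y ^+ (2 ^ k) + x ^+ (2 ^ k) * y.
  apply: (mulIf cc0); rewrite /pi divfK // /B /cc !addX conjK.
  have Gk : G k x y ^+ (2 ^ k) = G k x y by rewrite /G addX !exprMn !conjK; ring.
  rewrite [(c * _) ^+ _]exprMn Gk [x * _ + _]addrC -/(G k x y).
  move: (b * _) (G k x y) (c ^+ _) => w T c'; move: (w ^+ _) => w'.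
  by ring: c2'.
have [N NE] : exists N, (2 * k = N.+1)%N by exists (2 * k).-1; lia.
rewrite NE in dimK co_rn cardF.
have [a aE] := linearized_exists dimK co_rn pD.
have [|e eE] := linearized_exists (p := fun z => pi (Lam z)) dimK co_rn.
  by move=> x y; rewrite LD piD.
apply: (no_norm_projection cardF co_rn (esym NE) odd_r k_odd k_gt1 (a := a) (e := e)).
  by move=> y; have [x <-] := p_surj y; exists x; rewrite aE.
by move=> x y; rewrite -eE -!aE -pB piB.
Qed.
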